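(* The family of regular interval exchange sets is closed under maximal bifix decoding: if $S$ is a regular interval exchange set on a finite alphabet $A$, $X\subset S$ is a finite $S$-maximal bifix code and $f:B^*\to A^*$ is a coding morphism for $X$, then $f^{-1}(S)=\{w\in B^*\mid f(w)\in S\}$ is a regular interval exchange set on the alphabet $B$.
   Context: For a finite alphabet $A$ with two total orders $<_1,<_2$ and a partition $(I_a)_{a\in A}$ of $[0,1[$ into nonempty semi-intervals $[\alpha,\beta[$ ordered for $<_1$ (i.e. $a<_1 b$ implies $I_a$ lies to the left of $I_b$), set $\lambda_a=|I_a|$, $\mu_a=\sum_{b\le_1 a}\lambda_b$, $\nu_a=\sum_{b\le_2 a}\lambda_b$, $\alpha_a=\nu_a-\mu_a$; the interval exchange transformation relative to $(I_a)$ is $T(z)=z+\alpha_a$ for $z\in I_a$. Writing $A=\{a_1<_1\cdots<_1a_s\}$, $\mu_i=\mu_{a_i}$, $T$ is regular if the orbits $\{T^n(\mu_i)\mid n\in\mathbb{Z}\}$, $1\le i\le s-1$, are infinite and pairwise disjoint; regular transformations are minimal (every orbit dense). The natural coding $\Sigma_T(z)=a_0a_1\cdots$ has $a_n=a$ iff $T^n(z)\in I_a$; for minimal $T$ the set $F(T)$ of factors of $\Sigma_T(z)$ does not depend on $z$. A regular interval exchange set (on $A$) is a set of the form $F(T)$ for a regular interval exchange transformation $T$ on $A$. A bifix code is a set of nonempty words none of which is a proper prefix or proper suffix of another; a bifix code $X\subset S$ is $S$-maximal if not properly contained in any bifix code $Y\subset S$. A coding morphism for $X$ is a morphism $f:B^*\to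 A^*$ mapping the alphabet $B$ bijectively onto $X$. *)

(* Defs.v *)
From mathcomp Require Import all_boot all_order all_algebra.
From mathcomp Require Import all_classical reals.

Set Implicit Arguments.
Unset Strict Implicit.
Unset Printing Implicit Defensive.

Import Order.TTheory GRing.Theory Num.Theory.
Local Open Scope classical_set_scope.
Local Open Scope ring_scope.

Definition total_order (A : finType) (le : rel A) : Prop :=
  [/\ antisymmetric le, transitive le & total le].

(* The letter [a] is sent to the semi-interval [lo a, hi a[. The relations
   [le1] and [le2] are the reflexive versions of the orders <_1 and <_2. *)
Record interval_exchange (R : realType) (A : finType) := IntervalExchange {
  le1 : rel A;
  le2 : rel A;
  lo : A -> R;
  hi : A -> R;
  le1_total_order : total_order le1;
  le2_total_order : total_order le2;
  cells_partition :
    classical_sets.partition [set: A]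
      (fun a => [set` `[lo a, hi a[]) [set` `[0, 1[];
  cells_ordered : forall a b y z, le1 a b -> a != b ->
    y \in `[lo a, hi a[ -> z \in `[lo b, hi b[ -> y < z
}.

Section IntervalExchange.
Variables (R : realType) (A : finType) (T : interval_exchange R A).

Definition lambda (a : A) : R := hi T a - lo T a.
Definition mu (a : A) : R := \sum_(b | le1 T b a) lambda b.
Definition nu (a : A) : R := \sum_(b | le2 T b a) lambda b.
Definition alpha (a : A) : R := nu a - mu a.

(* Outside [0, 1[ the map is extended by the identity. *)
Definition iet_map (z : R) : R :=
  if [pick a | z \in `[lo T a, hi T a[] is Some a then z + alpha a else z.

(* The two-sided orbit {T^n(z) | n in Z}: as [iet_map] is a bijection,
   y = T^(-n)(z) is expressed as T^n(y) = z. *)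
Definition iet_orbit (z : R) : set R :=
  [set y | exists n : nat, iter n iet_map z = y \/ iter n iet_map y = z].

(* The letters a_1, ..., a_(s-1), i.e. all but the <_1-greatest one. *)
Definition nonmax : set A := [set a | exists2 b, le1 T a b & a != b].

Definition regular : Prop :=
  (forall a, nonmax a -> infinite_set (iet_orbit (mu a))) /\
  trivIset nonmax (fun a => iet_orbit (mu a)).

Definition natural_coding (z : R) (u : nat -> A) : Prop :=
  forall n a, u n = a <-> iter n iet_map z \in `[lo T a, hi T a[.

End IntervalExchange.

Definition factors (A : Type) (u : nat -> A) : set (seq A) :=
  [set w | exists n, w = map u (iota n (size w))].

(* S = F(T) for a regular T on A, where F(T) is the common value of the sets of
   factors of the natural codings of all the points z of [0, 1[. *)
Definition regular_interval_exchange_set (R : realType) (A : finType)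
    (S : set (seq A)) : Prop :=
  exists2 T : interval_exchange R A, regular T &
    forall z : R, z \in `[0, 1[ ->
      exists2 u, natural_coding T z u & S = factors u.

Definition bifix_code (A : eqType) (X : set (seq A)) : Prop :=
  [/\ ~ X [::],
      forall x y, X x -> X y -> seq.prefix x y -> x = y
    & forall x y, X x -> X y -> suffix x y -> x = y].

Definition maximal_bifix_code (A : eqType) (S X : set (seq A)) : Prop :=
  [/\ bifix_code X, X `<=` S
    & forall Y, bifix_code Y -> Y `<=` S -> ~ X `<` Y].

Definition word_morphism (A B : Type) (f : seq B -> seq A) : Prop :=
  f [::] = [::] /\ forall u v, f (u ++ v) = f u ++ f v.

Definition coding_morphism (A B : Type) (X : set (seq A))
    (f : seq B -> seq A) : Prop :=
  word_morphism f /\ set_bij [set: B] X (fun b => f [:: b]).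

(* Main.v *)
(* Cut [0, 1[ along the words of X: the points whose coding starts with x form
   a semi-interval I_x, on which T^|x| is a translation. The I_x are disjoint
   as X is prefix, their images J_x are disjoint as X is suffix, and I_x and
   J_x have the same length. If the I_x did not cover [0, 1[, neither would the
   J_x, and by recurrence S would contain a word with no prefix and no suffix
   comparable with X, against maximality. Hence T_f = T^|x| on I_x is an
   interval exchange. A nonzero left end of I_x reaches a separation point of T
   in fewer than |x| steps, so a connection of T_f would give one of T: T_f is
   regular. By Keane's theorem its orbits are dense, hence every w with f(w) in
   S occurs in the coding of every point under T_f.

   Keane's theorem is proved on forward orbits: the right end b of a gap of an
   orbit is carried by T to right ends of gaps as long as it is not a
   separation point, and likewise by T^-1. Gaps of equal length with distinct
   right ends are disjoint, so neither iteration goes on forever, which yields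
   a connection. *)
Require Import Defs.
From mathcomp Require Import all_boot all_order all_algebra.
From mathcomp Require Import all_classical reals.
From mathcomp Require Import lra zify.
Set Implicit Arguments.
Unset Strict Implicit.
Unset Printing Implicit Defensive.
Import Order.TTheory GRing.Theory Num.Theory.
Local Open Scope classical_set_scope.
Local Open Scope ring_scope.

(** * Tilings by semi-intervals *)

Section Tilings.
Variables (R : realType) (A : finType).
Implicit Types (lo hi : A -> R) (a b : A) (P : {set A}).

Definition cell lo hi a (z : R) : bool := lo a <= z < hi a.

Definition disjoint_cells lo hi : Prop :=
  forall a b z, cell lo hi a z -> cell lo hi b z -> a = b.

Definition tiling lo hi : Prop :=
  [/\ forall a, [/\ 0 <= lo a, lo a < hi a & hi a <= 1],
      forall z, 0 <= z < 1 -> exists a, cell lo hi a z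
    & disjoint_cells lo hi].

Lemma disjoint_cells_lt lo hi a b : (forall a, lo a < hi a) ->
  disjoint_cells lo hi -> a != b -> lo a <= lo b -> hi a <= lo b.
Proof.
move=> lh D ab le_ab; rewrite leNgt; apply/negP => lt.
have ab' : a = b by apply: (D a b (lo b)); rewrite /cell; have := lh b; lra.
by rewrite ab' eqxx in ab.
Qed.

(** The cell of [P] with the greatest left end is removed; by disjointness the others end before it,
    so they are packed in a shorter interval. *)
Lemma packing lo hi P l h : (forall a, lo a < hi a) -> disjoint_cells lo hi ->
  l <= h -> (forall a, a \in P -> l <= lo a /\ hi a <= h) ->
  \sum_(a in P) (hi a - lo a) <= h - l.
Proof.
move=> lh D; have [n] := ubnP #|P|.
elim: n P h => // n IH P h /ltnSE le_Pn l_h inP.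
have [->|[a0 Pa0]] := set_0Vmem P; first by rewrite big_set0; lra.
pose b := [arg max_(i > a0 in P) lo i]%O.
have [Pb maxb] : b \in P /\ forall a, a \in P -> lo a <= lo b.
  by rewrite /b; case: arg_maxP => // i Pi mi; split => // a /mi.
have [l_b b_h] := inP _ Pb.
rewrite (big_setD1 b) //=.
have /IH : (#|P :\ b| < n)%N by rewrite (leq_trans _ le_Pn) // [in leqRHS](cardsD1 b) Pb.
move=> /(_ (lo b) l_b).
have H : forall a, a \in P :\ b -> l <= lo a /\ hi a <= lo b.
  move=> a; rewrite !inE => /andP[ab Pa]; have [la _] := inP _ Pa.
  by split=> //; apply: disjoint_cells_lt => //; exact: maxb.
by move=> /(_ H); lra.
Qed.

(** The cell containing [l] is removed; the others still cover what remains beyond its right end. *)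
Lemma covering lo hi P l h : (forall a, lo a < hi a) ->
  (forall z, l <= z < h -> exists2 a, a \in P & cell lo hi a z) ->
  h - l <= \sum_(a in P) (hi a - lo a).
Proof.
move=> lh; have [n] := ubnP #|P|.
elim: n P l => // n IH P l /ltnSE le_Pn cov.
have [hl|lt_lh] := leP h l.
  apply: (@le_trans _ _ 0); first by lra.
  by apply: sumr_ge0 => a _; have := lh a; lra.
have [|a Pa /andP[la ha]] := cov l; first by lra.
rewrite (big_setD1 a) //=.
have /IH : (#|P :\ a| < n)%N by rewrite (leq_trans _ le_Pn) // [in leqRHS](cardsD1 a) Pa.
move=> /(_ (hi a)) H.
have {}H : h - hi a <= \sum_(i in P :\ a) (hi i - lo i).
  apply: H => z zP; have [|b Pb zb] := cov z; first by lra.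
  exists b => //; rewrite !inE Pb andbT; apply: contraTneq zb => ->.
  by rewrite /cell; lra.
by lra.
Qed.

Lemma tiling_lt lo hi a : tiling lo hi -> lo a < hi a.
Proof. by case=> + _ _ => /(_ a)[]. Qed.

Lemma tiling_sum lo hi : tiling lo hi -> \sum_a (hi a - lo a) = 1.
Proof.
move=> til; have lh a := tiling_lt a til; case: til => bnd cov D.
have E : \sum_a (hi a - lo a) = \sum_(a in [set: A]%SET) (hi a - lo a).
  by apply: eq_bigl => a; rewrite inE.
apply/eqP; rewrite eq_le E; apply/andP; split.
  rewrite -[leRHS]subr0; apply: packing => // a _.
  by have [? ? ?] := bnd a.
rewrite -[leLHS]subr0; apply: covering => // z /cov[a az].
by exists a => //; rewrite inE.
Qed.

(** If [z] were uncovered, the cells on its left would have total length at most [z], and those on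
    its right at most [1 - m], where [m > z] bounds their left ends from below; the sum would be
    less than 1. *)
Lemma sum1_tiling lo hi : (forall a, [/\ 0 <= lo a, lo a < hi a & hi a <= 1]) ->
  disjoint_cells lo hi -> \sum_a (hi a - lo a) = 1 -> tiling lo hi.
Proof.
move=> bnd D sum1; split => // z /andP[z0 z1].
have lh a : lo a < hi a by have [] := bnd a.
apply: contrapT => nz.
have {}nz a : ~~ cell lo hi a z by apply/negP => az; apply: nz; exists a.
pose above := [set a | z < lo a]%SET.
(* The default 1 covers the case of no cell on the right of [z]. *)
pose m := \big[Order.min/1]_(a in above) lo a.
have zm : z < m.
  by rewrite /m; elim/big_ind: _ => // [x y ? ?|a]; rewrite ?inE // lt_min; apply/andP.
have m1 : m <= 1 by rewrite /m; apply: bigmin_le_id.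
have := @packing lo hi above m 1 lh D m1.
have := @packing lo hi (~: above) 0 z lh D z0.
have H1 a : a \in above -> m <= lo a /\ hi a <= 1.
  by move=> aP; have [_ _ ?] := bnd a; split=> //; apply: bigmin_le_cond.
have H2 a : a \in ~: above -> 0 <= lo a /\ hi a <= z.
  rewrite !inE -leNgt => laz; have [? _ _] := bnd a; split=> //.
  by have := nz a; rewrite /cell laz /= -leNgt.
move=> /(_ H2) S2 /(_ H1) S1.
have : \sum_a (hi a - lo a) = \sum_(a in above) (hi a - lo a) + \sum_(a in ~: above) (hi a - lo a).
  by rewrite (bigID (mem above)) /=; congr (_ + _); apply: eq_bigl => a; rewrite !inE.
by rewrite sum1; lra.
Qed.

(** The cells up to [a] exactly fill [[0, hi a[]. This identifies [mu] with right ends of cells and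
    [nu] with right ends of image cells. *)
Lemma tiling_down_sum lo hi (le : rel A) : tiling lo hi -> total le ->
  reflexive le -> (forall a b, le a b -> a != b -> hi a <= lo b) ->
  forall a, \sum_(b | le b a) (hi b - lo b) = hi a.
Proof.
move=> til tot lexx leP a.
have lh c := tiling_lt c til; have [bnd cov D] := til.
have E : \sum_(b | le b a) (hi b - lo b) = \sum_(b in [set b | le b a]%SET) (hi b - lo b).
  by apply: eq_bigl => b; rewrite inE.
apply/eqP; rewrite eq_le E; apply/andP; have [a0 a01 a1] := bnd a; split.
  rewrite -[leRHS]subr0; apply: packing => //; first lra.
  move=> b; rewrite inE => ba; have [? _ _] := bnd b; split=> //.
  have [->//|bna] := eqVneq b a.
  by have := leP _ _ ba bna; lra.
rewrite -[leLHS]subr0; apply: covering => // z zP.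
have [|b bz] := cov z; first by lra.
exists b => //; rewrite inE; have [//|ab] := orP (tot b a).
have [->//|bna] := eqVneq b a.
have := leP _ _ ab; rewrite eq_sym => /(_ bna); move: bz; rewrite /cell; lra.
Qed.

End Tilings.

(** * Exchanges of semi-intervals *)

Section Exchanges.
Variables (R : realType) (A : finType) (lo hi s : A -> R) (T : R -> R).

(** An interval exchange without its two orders, which can be read off the two tilings; [T] is
    arbitrary outside [[0, 1[]. *)
Definition exchange : Prop :=
  [/\ tiling lo hi, tiling (fun a => lo a + s a) (fun a => hi a + s a)
    & forall a z, cell lo hi a z -> T z = z + s a].

(** Keane's condition: the positive left ends are the separation points. The case [a = b] forbids
    periodic ones, hence at least one step, [n.+1]. *)
Definition no_connection : Prop :=
  forall a b n, 0 < lo a -> 0 < lo b -> iter n.+1 T (lo a) <> lo b.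

Hypothesis exchT : exchange.

Lemma exchange_bnd a : [/\ 0 <= lo a, lo a < hi a & hi a <= 1].
Proof. by case: exchT => -[]. Qed.

Lemma exchange_img_bnd a : 0 <= lo a + s a /\ hi a + s a <= 1.
Proof. by case: exchT => _ [/(_ a)[]]. Qed.

Lemma exchange_cell z : 0 <= z < 1 -> exists a, cell lo hi a z.
Proof. by case: exchT => -[_ cov _] _ _; exact: cov. Qed.

Lemma exchange_img_cell z : 0 <= z < 1 ->
  exists a, cell (fun a => lo a + s a) (fun a => hi a + s a) a z.
Proof. by case: exchT => _ [_ cov _] _; exact: cov. Qed.

Lemma exchange_disj : disjoint_cells lo hi.
Proof. by case: exchT => -[]. Qed.

Lemma cell_lo a : cell lo hi a (lo a).
Proof. by have [_ ? _] := exchange_bnd a; rewrite /cell; lra. Qed.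

Lemma cell_in a z : cell lo hi a z -> 0 <= z < 1.
Proof. by have [? _ ?] := exchange_bnd a; rewrite /cell; lra. Qed.

Lemma lo_in a : 0 <= lo a < 1.
Proof. exact: cell_in (cell_lo a). Qed.

Lemma lo_inj : injective lo.
Proof.
move=> a b ab; apply: (exchange_disj (cell_lo a)).
by rewrite ab; exact: cell_lo.
Qed.

Lemma exchangeE a z : cell lo hi a z -> T z = z + s a.
Proof. by case: exchT => _ _; exact. Qed.

Lemma exchange_in z : 0 <= z < 1 -> 0 <= T z < 1.
Proof.
move=> /exchange_cell[a az]; rewrite (exchangeE az).
by have [? ?] := exchange_img_bnd a; move: az; rewrite /cell; lra.
Qed.

Lemma iter_exchange_in n z : 0 <= z < 1 -> 0 <= iter n T z < 1.
Proof. by move=> z01; elim: n => //= n; exact: exchange_in. Qed.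

Lemma exchange_inj y z : 0 <= y < 1 -> 0 <= z < 1 -> T y = T z -> y = z.
Proof.
move=> /exchange_cell[a ay] /exchange_cell[b bz].
rewrite (exchangeE ay) (exchangeE bz) => E.
have ab : a = b.
  case: exchT => _ [_ _ D] _; apply: (D a b (y + s a)); rewrite /cell.
    by move: ay; rewrite /cell; lra.
  by move: bz; rewrite /cell E; lra.
by move: E; rewrite ab; lra.
Qed.

Lemma iter_exchange_inj n y z : 0 <= y < 1 -> 0 <= z < 1 ->
  iter n T y = iter n T z -> y = z.
Proof.
move=> y01 z01; elim: n => //= n IH /exchange_inj E; apply: IH; apply: E;
exact: iter_exchange_in.
Qed.

Lemma exchange_img_cellE a y :
  cell (fun a => lo a + s a) (fun a => hi a + s a) a y ->
  cell lo hi a (y - s a) /\ T (y - s a) = y.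
Proof.
rewrite {1}/cell => ay; have c : cell lo hi a (y - s a) by rewrite /cell; lra.
by split => //; rewrite (exchangeE c); lra.
Qed.

Lemma exchange_surj y : 0 <= y < 1 -> exists2 z, 0 <= z < 1 & T z = y.
Proof.
by move=> /exchange_img_cell[a /exchange_img_cellE[/cell_in ? ?]]; exists (y - s a).
Qed.

Lemma exchange0 : exists a, T (lo a) = 0.
Proof.
have /exchange_img_cell[a] : 0 <= (0 : R) < 1 by lra.
have [? ?] := exchange_img_bnd a; rewrite /cell => /andP[? _].
by exists a; rewrite (exchangeE (cell_lo a)); lra.
Qed.

Hypothesis nc : no_connection.
(** Excludes the single cell [[0, 1[], for which [no_connection] holds vacuously while [T] fixes
    every point. *)
Hypothesis cut : exists a, 0 < lo a.

(* If [0, h[ were a fixed cell, h would be the image of another left end. *)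
Lemma exchange0_neq0 : T 0 <> 0.
Proof.
move=> T0; have [c0 c0P] : exists a, cell lo hi a 0 by apply: exchange_cell; lra.
have [b b_gt0] := cut.
have lo0 : lo c0 = 0 by have [? ? ?] := exchange_bnd c0; move: c0P; rewrite /cell; lra.
have s0 : s c0 = 0 by have := exchangeE c0P; rewrite T0; lra.
set h := hi c0; have h_gt0 : 0 < h by move: c0P; rewrite /cell -/h; lra.
have fixh y : 0 <= y < h -> T y = y.
  by move=> yP; rewrite (@exchangeE c0) ?s0 ?addr0 // /cell lo0.
have h01 : 0 <= h < 1.
  have cb : c0 != b by apply/eqP => E; move: b_gt0; rewrite -E lo0 ltxx.
  have := @disjoint_cells_lt _ _ lo hi c0 b _ exchange_disj cb.
  have [? ? ?] := exchange_bnd b; rewrite -/h => H.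
  have : h <= lo b by apply: H; [move=> a; case: (exchange_bnd a)|lra].
  by lra.
have [d0 d0h] := exchange_cell h01.
have lod0 : lo d0 = h.
  apply/eqP; rewrite eq_le; apply/andP; split; first by case/andP: d0h.
  rewrite leNgt; apply/negP => lt.
  have [? ? ?] := exchange_bnd d0.
  have E : d0 = c0.
    by apply: (@exchange_disj _ _ (lo d0)); [exact: cell_lo|rewrite /cell lo0 -/h; lra].
  by move: d0h; rewrite E /cell -/h; lra.
have [y y01 Ty] := exchange_surj h01.
have [d dy] := exchange_cell y01.
have [ylo|] := eqVneq y (lo d).
  have [lod|/negP] := boolP (0 < lo d).
    by apply: (@nc d d0 0%N) => //=; rewrite ?lod0 // -ylo.
  have [? ? ?] := exchange_bnd d => ?.
  have lod : lo d = 0 by lra.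
  by move: Ty; rewrite ylo lod T0; lra.
move=> ynlo; have ylt : lo d < y by rewrite lt_neqAle eq_sym ynlo; case/andP: dy.
(* Now [y] is not a left end, so it can be moved left by [e]: both [y - e] and the fixed point
   [h - e] are sent to [h - e], whence [y = h = lo d]. *)
pose e := Num.min (y - lo d) h.
have [e1 e2] : e <= y - lo d /\ e <= h by rewrite /e !ge_min !lexx orbT.
have e0 : 0 < e by rewrite lt_min; lra.
have dye : cell lo hi d (y - e) by move: dy; rewrite /cell; lra.
have Tye : T (y - e) = h - e.
  by rewrite (exchangeE dye) -Ty (exchangeE dy); lra.
have E : y - e = h - e.
  apply: exchange_inj; [exact: cell_in dye|lra|].
  by rewrite Tye fixh //; lra.
have yh : y = h by lra.
have dd0 : d = d0 by apply: (exchange_disj dy); rewrite yh.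
by move: ylt; rewrite dd0 lod0 yh ltxx.
Qed.

(* Sliding a periodic orbit to the left until it meets the left end of a cell
   makes that left end periodic. *)
Lemma exchange_aperiodic z n : 0 <= z < 1 -> iter n.+1 T z <> z.
Proof.
move=> z01 per; set p := n.+1 in per.
have /choice[c cP] : forall k : 'I_p, exists a, cell lo hi a (iter k T z).
  by move=> k; exact/exchange_cell/iter_exchange_in.
pose d (k : 'I_p) := iter k T z - lo (c k).
pose k0 := [arg min_(k < (ord0 : 'I_p)) d k]%O.
have min_d k : d k0 <= d k by rewrite /k0; case: arg_minP => // i _; exact.
have d_ge0 : 0 <= d k0 by have := cP k0; rewrite /cell /d; lra.
set y := z - d k0.
have cy (k : 'I_p) : cell lo hi (c k) (iter k T z - d k0).
  by have := cP k; have := min_d k; rewrite /cell {2}/d; lra.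
have yk k : (k <= p)%N -> iter k T y = iter k T z - d k0.
  elim: k => // k IH kp; rewrite !iterS IH 1?ltnW //.
  by rewrite (exchangeE (cy (Ordinal kp))) (exchangeE (cP (Ordinal kp))); lra.
have y01 : 0 <= y < 1 by have := cell_in (cy ord0).
have pery : iter p T y = y by rewrite yk // per.
have lok0 : iter k0 T y = lo (c k0).
  by rewrite yk ?(ltnW (ltn_ord k0)) // /d; lra.
have perlo : iter p T (lo (c k0)) = lo (c k0).
  by rewrite -lok0 -iterD addnC iterD pery.
have [pos|npos] := ltP 0 (lo (c k0)); first exact: (nc pos pos perlo).
have lo0 : lo (c k0) = 0 by have [? ? ?] := exchange_bnd (c k0); lra.
rewrite lo0 in perlo.
(* The left end 0 is not a separation point, but its preimage is one, and it is periodic as well. *)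
have [a Ta] := exchange0.
have apos : 0 < lo a.
  have [? ? ?] := exchange_bnd a; rewrite lt_neqAle; apply/andP; split => //.
  by apply/negP => /eqP E; apply: exchange0_neq0; rewrite {1}E.
apply: (nc apos apos (n := n)).
apply: (@iter_exchange_inj 1); [exact/iter_exchange_in/lo_in|exact: lo_in|].
by rewrite /= -iterS iterSr Ta.
Qed.

End Exchanges.

Lemma iter_injective (R : realType) (G : R -> R) (x : R) :
  (forall y, 0 <= y < 1 -> 0 <= G y < 1) ->
  (forall y z, 0 <= y < 1 -> 0 <= z < 1 -> G y = G z -> y = z) ->
  (forall y n, 0 <= y < 1 -> iter n.+1 G y <> y) ->
  0 <= x < 1 -> injective (fun n => iter n G x).
Proof.
move=> Gin Ginj Gap x01 n m.
have in01 k : 0 <= iter k G x < 1 by elim: k => //= k; exact: Gin.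
have key i j : iter i G x = iter (i + j.+1) G x -> False.
  elim: i => [E|i IH]; first by apply: (Gap x j) => //; rewrite -[RHS]E.
  by rewrite addSn !iterS => /(Ginj _ _ (in01 _) (in01 _)).
have [nm|mn|//] := ltngtP n m => E; exfalso.
  by apply: (key n (m - n.+1)%N); rewrite E; congr (iter _ G x); lia.
by apply: (key m (n - m.+1)%N); rewrite -E; congr (iter _ G x); lia.
Qed.

(** * Keane's theorem *)

Section Gaps.
Variables (R : realType) (O : R -> Prop).

Definition gap (b e : R) : Prop := 0 <= b - e /\ forall y, O y -> ~~ (b - e < y < b).

(** [b] itself may lie in [O]. Together with [gap b e], this makes [b] the exact right end of a
    gap. *)
Definition right_limit (b : R) : Prop :=
  forall e, 0 < e -> exists2 y, O y & b <= y < b + e.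

Lemma gap_le b e e' : e' <= e -> gap b e -> gap b e'.
Proof.
move=> ee' [be gp]; split; first lra.
by move=> y /gp; apply: contraNN; lra.
Qed.

Lemma gap_separated b b' e : right_limit b -> gap b' e -> b < b' -> b <= b' - e.
Proof.
move=> rb [_ gb'] bb'; rewrite leNgt; apply/negP => lt.
have [|y Oy yP] := rb (b' - b); first lra.
by have /negP := gb' y Oy; apply; lra.
Qed.

(** Points of [O] close to one right end cannot lie in another gap, so the gaps are disjoint; more
    than [1/e] of them do not fit in [[0, 1]]. *)
Lemma no_equal_gaps (b : nat -> R) e : injective b -> 0 < e ->
  (forall n, b n < 1) -> (forall n, right_limit (b n)) ->
  (forall n, gap (b n) e) -> False.
Proof.
move=> b_inj e0 b1 rl gp; pose N := Num.bound e^-1.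
have lh (i : 'I_N) : b i - e < b i by lra.
have D : @disjoint_cells R 'I_N (fun i => b i - e) b.
  move=> i j z; rewrite /cell => iz jz; apply/val_inj/b_inj => /=.
  have [lt|lt|//] := ltgtP (b i) (b j).
    by have := gap_separated (rl i) (gp j) lt; lra.
  by have := gap_separated (rl j) (gp i) lt; lra.
have := packing (P := [set: 'I_N]%SET) (l := 0) (h := 1) lh D ler01.
have H : forall a : 'I_N, a \in [set: 'I_N]%SET -> 0 <= b a - e /\ b a <= 1.
  by move=> a _; split; [case: (gp a)|exact/ltW/b1].
move=> /(_ H).
rewrite (eq_bigr (fun=> e)); last by move=> i _; lra.
rewrite sumr_const cardsT card_ord subr0 -[e *+ _]mulr_natr => Ne.
have : e^-1 < N%:R by apply: archi_boundP; rewrite invr_ge0 ltW.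
by rewrite -(ltr_pM2l e0) mulfV ?gt_eqF // => /lt_le_trans/(_ Ne); rewrite ltxx.
Qed.

Definition avoids (F : seq R) (b e : R) : Prop :=
  forall p, p \in F -> ~~ (b - e < p < b).

Lemma avoids_le F b e e' : e' <= e -> avoids F b e -> avoids F b e'.
Proof. by move=> ee' av p /av; apply: contraNN; lra. Qed.

Lemma avoids_exists F b : exists2 e, 0 < e & avoids F b e.
Proof.
elim: F => [|p F [e e0 av]]; first by exists 1.
have [pb|bp] := ltP p b; last first.
  by exists e => // q; rewrite inE => /orP[/eqP ->|/av //]; lra.
exists (Num.min e (b - p)); first by rewrite lt_min; lra.
have [m1 m2] : Num.min e (b - p) <= e /\ Num.min e (b - p) <= b - p.
  by rewrite !ge_min !lexx orbT.
move=> q; rewrite inE => /orP[/eqP ->|qF]; first by lra.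
exact: (avoids_le m1 av).
Qed.

(* A point of F lies at most once immediately to the left of a term of b. *)
Lemma eventually_not_adjacent (F : seq R) (b : nat -> R) : injective b ->
  (forall n, right_limit (b n)) ->
  exists N, forall n p, (N <= n)%N -> p \in F -> p < b n ->
    exists2 y, O y & p < y < b n.
Proof.
move=> b_inj rl; elim: F => [|p F [N NP]]; first by exists 0%N.
pose adj n := p < b n /\ forall y, O y -> ~~ (p < y < b n).
have nadj n : p < b n -> ~ adj n -> exists2 y, O y & p < y < b n.
  move=> pb; apply: contra_notP => ne; split=> // y Oy; apply/negP => yP.
  by apply: ne; exists y.
have [[n0 [pb0 ad0]]|no] := pselect (exists n, adj n); last first.
  exists N => n q Nn; rewrite inE => /orP[/eqP -> pb|]; last exact: NP.
  by apply: nadj => // a; apply: no; exists n.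
exists (maxn N n0.+1) => n q; rewrite geq_max => /andP[Nn n0n].
rewrite inE => /orP[/eqP -> pb|]; last exact: NP.
apply: nadj => // -[_ ad].
have : b n0 != b n by apply/eqP => /b_inj E; move: n0n; rewrite E ltnn.
rewrite neq_lt => /orP[lt|lt].
  have [|y Oy yP] := rl n0 (b n - b n0); first lra.
  by have /negP := ad y Oy; apply; lra.
have [|y Oy yP] := rl n (b n0 - b n); first lra.
by have /negP := ad0 y Oy; apply; lra.
Qed.

(* The gaps on the left of the iterates can only shrink at the points of F,
   which happens finitely often, so their lengths are bounded below. *)
Lemma no_gap_orbit (F : seq R) (p : R) (G : R -> R) (K : R -> Prop) (b e : R) :
  (forall x, K x -> x < 1 /\ right_limit x) ->
  (forall x e, K x -> 0 < e -> gap x e -> K (G x)) ->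
  (forall x e, K x -> 0 < e -> gap x e -> avoids F x e ->
    0 <= G x - e /\ forall y, O y -> G x - e < y < G x -> y = p) ->
  injective (fun n => iter n G b) -> K b -> 0 < e -> gap b e -> False.
Proof.
move=> KP KG gapG b_inj Kb e0 gb.
have Kn n : K (iter n G b) /\ exists2 e, 0 < e & gap (iter n G b) e.
  elim: n => [|n [Kn [e1 e10 gn]]]; first by split => //; exists e.
  split; first exact: KG gn.
  (* The gap is shortened to contain no point of [F], and its image to miss [p], the only point of
     [O] that may appear there. *)
  have [e2 e20 av2] := avoids_exists F (iter n G b).
  have [e3 e30 av3] := avoids_exists [:: p] (G (iter n G b)).
  pose m := Num.min e1 (Num.min e2 e3).
  have m0 : 0 < m by rewrite !lt_min e10 e20.
  have m1 : m <= e1 by rewrite !ge_min lexx.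
  have m2 : m <= e2 by rewrite !ge_min lexx orbT.
  have m3 : m <= e3 by rewrite !ge_min lexx !orbT.
  have [//|//|||Gm Op] := gapG (iter n G b) m; [exact: gap_le gn|exact: avoids_le av2|].
  exists m => //=; split=> // y Oy; apply/negP => yP.
  have /negP := av3 p (mem_head _ _); apply; rewrite -(Op y Oy yP); lra.
have rl n : right_limit (iter n G b) by have [/KP[]] := Kn n.
have [N NP] := eventually_not_adjacent (p :: F) b_inj rl.
have [_ [e1 e10 gN]] := Kn N.
have gn n : gap (iter (N + n) G b) e1.
  elim: n => [|n IH]; first by rewrite addn0.
  have [Kk _] := Kn (N + n)%N.
  (* From rank [N] on, a point of [F] inside the gap would have a point of [O] between it and the
     right end, against the gap. *)
  have av : avoids F (iter (N + n) G b) e1.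
    move=> q qF; apply/negP => qP.
    have [|||y Oy yP] := NP (N + n)%N q; [exact: leq_addr|by rewrite inE qF orbT|lra|].
    by have [_ /(_ y Oy)/negP] := IH; apply; lra.
  have [Gm Op] := gapG _ _ Kk e10 IH av.
  rewrite addnS /=; split=> // y Oy; apply/negP => yP.
  (* If [p] lay in the image gap, a point of [O] strictly between [p] and the right end would also
     have to equal [p]. *)
  have [|||y' Oy' y'P] := NP (N + n).+1 p;
    [by rewrite -addnS leq_addr|exact: mem_head|by rewrite /= -(Op y Oy yP); lra|].
  have yp := Op y Oy yP; move: y'P; rewrite /= => y'P.
  have : y' = p by apply: Op => //; rewrite -yp in y'P; lra.
  by lra.
apply: (@no_equal_gaps (fun n => iter (N + n) G b) e1) => //.
  by move=> n m /b_inj /addnI.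
by move=> n; have [/KP[]] := Kn (N + n)%N.
Qed.
End Gaps.

(** * Minimality of exchanges without connections *)

Section Minimality.
Variables (R : realType) (A : finType) (lo hi s : A -> R) (T : R -> R).
Hypothesis exchT : exchange lo hi s T.
Hypothesis nc : no_connection lo T.
Hypothesis cut : exists a, 0 < lo a.

Lemma exchange_inverse : exists T' : R -> R, forall y, 0 <= y < 1 ->
  0 <= T' y < 1 /\ T (T' y) = y.
Proof.
have /choice[T' T'P] : forall y : R, exists z, 0 <= y < 1 -> 0 <= z < 1 /\ T z = y.
  move=> y; have [y01|_] := boolP (0 <= y < 1); last by exists 0.
  by have [z z01 Tz] := exchange_surj exchT y01; exists z.
by exists T'.
Qed.

Section AvoidingOrbit.
Variable z : R.
Hypothesis z01 : 0 <= z < 1.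
Hypothesis z_avoids : forall n a, 0 < lo a -> iter n T z <> lo a.

Let O (y : R) : Prop := exists n, y = iter n T z.

Let O_in y : O y -> 0 <= y < 1.
Proof. by move=> [n ->]; exact: (iter_exchange_in exchT). Qed.

Let O_fwd y : O y -> O (T y).
Proof. by move=> [n ->]; exists n.+1. Qed.

(** [O] is a forward orbit, so its origin [z] need not have a preimage in it: [z] is the exceptional
    point [p] of [no_gap_orbit]. *)
Let O_bwd (y : R) : 0 <= y < 1 -> O (T y) -> T y = z \/ O y.
Proof.
move=> y01 [[|n]]; first by left.
move=> /= /(exchange_inj exchT y01) E; right; exists n; apply: E.
exact: (iter_exchange_in exchT).
Qed.

(** The backward iterates of [lo a] never meet the left end of an image cell, as this would give a
    connection. So [T'] is a translation around each of them and carries gaps along forever, against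
    [no_gap_orbit]. *)
Lemma backward_gap a e : right_limit O (lo a) -> 0 < e -> gap O (lo a) e -> False.
Proof.
move=> rl e0 ga; have [T' T'P] := exchange_inverse.
have la0 : 0 < lo a by case: ga; lra.
pose K x := [/\ 0 <= x < 1, right_limit O x & exists n, iter n T x = lo a].
have KO x : K x -> ~ O x.
  move=> [_ _ [n nx]] [k xk]; apply: (z_avoids (n := n + k) la0).
  by rewrite iterD -xk.
have Klo x c : K x -> x <> lo c + s c.
  rewrite -(exchangeE exchT (cell_lo exchT c)) => -[_ _ [n nx]] E.
  have [lc|] := boolP (0 < lo c).
    by apply: (nc (n := n) lc la0); rewrite iterSr -E.
  have [? ? ?] := exchange_bnd exchT c => lc.
  have lc0 : lo c = 0 by lra.
  (* The left end 0 is the image of a positive left end, from which the connection is one step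
     longer. *)
  have [d Td] := exchange0 exchT.
  have ld : 0 < lo d.
    have [ld _ _] := exchange_bnd exchT d.
    rewrite lt_neqAle ld andbT; apply/negP => /eqP E'.
    by apply: (exchange0_neq0 exchT nc cut); rewrite {1}E'.
  by apply: (nc (n := n.+1) ld la0); rewrite !iterSr Td -lc0 -E.
have T'E x d : cell lo hi d (x - s d) -> 0 <= x < 1 -> T' x = x - s d.
  move=> cd x01; have [? E] := T'P x x01.
  apply: (exchange_inj exchT) => //; first exact: (cell_in exchT cd).
  by rewrite E (exchangeE exchT cd); lra.
have Kcell x : K x -> exists d, [/\ cell lo hi d (x - s d), lo d + s d < x,
    x < hi d + s d & T' x = x - s d].
  move=> Kx; have [x01 _ _] := Kx.
  have [d dx] := exchange_img_cell exchT x01.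
  have [cd _] := exchange_img_cellE exchT dx.
  exists d; split => //; last by apply: T'E.
    rewrite lt_neqAle; apply/andP; split; last by case/andP: dx.
    by apply/eqP => E; exact: (Klo x d Kx).
  by case/andP: dx.
apply: (@no_gap_orbit R O [seq lo c + s c | c : A] z T' K (lo a) e) => //.
- by move=> x [/andP[]].
- move=> x e1 Kx _ _; have [x01 rx [n nx]] := Kx; have [? TT'] := T'P x x01.
  split => //; last by exists n.+1; rewrite iterSr TT'.
  have [d [cd xlo xhi ->]] := Kcell x Kx.
  move=> e2 e20.
  (* The last bound keeps [z], which may have no preimage in [O], out of the window on the right of
     [x]. If [z <= x] any bound will do, since [y] differs from [x], a point outside [O]. *)
  pose e3 := Num.min (Num.min e2 (hi d + s d - x)) (if x < z then z - x else 1).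
  have e30 : 0 < e3 by rewrite !lt_min; case: ifP => ?; lra.
  have [m1 m2] : e3 <= e2 /\ e3 <= hi d + s d - x by rewrite /e3 !ge_min !lexx ?orbT.
  have m3 : x < z -> e3 <= z - x by move=> xz; rewrite /e3 xz !ge_min lexx orbT.
  have [y Oy yP] := rx e3 e30.
  have yx : x != y by apply/eqP => E; apply: (KO x Kx); rewrite E.
  have cy : cell lo hi d (y - s d) by rewrite /cell; lra.
  have Ty : T (y - s d) = y by rewrite (exchangeE exchT cy); lra.
  exists (y - s d); last by lra.
  have [||yz|//] := @O_bwd (y - s d); first exact: (cell_in exchT cy).
    by rewrite Ty.
  rewrite Ty in yz; have xz : x < z by rewrite -yz lt_neqAle yx; lra.
  by have := m3 xz; lra.
- move=> x e1 Kx e10 [xe1 gx] av.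
  have [d [cd xlo xhi ->]] := Kcell x Kx.
  have nd : ~~ (x - e1 < lo d + s d < x) by apply: av; apply/mapP; exists d; rewrite ?mem_enum.
  have [? ? ?] := exchange_bnd exchT d.
  split; first by lra.
  move=> y Oy yP; exfalso.
  have cy : cell lo hi d y by rewrite /cell; lra.
  have := gx _ (O_fwd Oy); rewrite (exchangeE exchT cy); lra.
- apply: iter_injective; last exact: lo_in exchT a.
  + by move=> y /T'P[].
  + by move=> y y' /T'P[_ {2}<-] /T'P[_ {2}<-] ->.
  + move=> y n y01 E; apply: (exchange_aperiodic exchT nc cut (n := n) y01).
    rewrite -{1}E; elim: n.+1 {E} => // k IH.
    rewrite iterSr -[in RHS]IH; congr (iter k T _).
    suff /T'P[] : 0 <= iter k T' y < 1 by [].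
    by elim: k {IH} => //= k; case/T'P.
- by split => //; [exact: lo_in exchT a|exists 0%N].
Qed.

(** By [backward_gap] the right end of a gap is never a left end of a cell, so [T] is a translation
    around it and carries gaps along forever. *)
Lemma forward_gap b e : 0 <= b < 1 -> right_limit O b -> 0 < e -> gap O b e -> False.
Proof.
move=> b01 rl e0 gb.
pose K x := 0 <= x < 1 /\ right_limit O x.
have Kcell x e1 : K x -> 0 < e1 -> gap O x e1 ->
    exists d, [/\ cell lo hi d x, lo d < x & T x = x + s d].
  move=> [x01 rx] e10 gx; have [d dx] := exchange_cell exchT x01.
  exists d; split => //; last exact: (exchangeE exchT).
  rewrite lt_neqAle; case/andP: dx => -> _; rewrite andbT; apply/eqP => E.
  by apply: (@backward_gap d e1); rewrite ?E.
apply: (@no_gap_orbit R O [seq lo c | c : A] z T K b e) => //.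
- by move=> x [/andP[]].
- move=> x e1 Kx e10 gx; have [d [cd xlo Tx]] := Kcell x e1 Kx e10 gx.
  have [x01 rx] := Kx; split; first exact: (exchange_in exchT).
  move=> e2 e20; pose e3 := Num.min e2 (hi d - x).
  have e30 : 0 < e3 by rewrite lt_min; move: cd; rewrite /cell; lra.
  have [m1 m2] : e3 <= e2 /\ e3 <= hi d - x by rewrite /e3 !ge_min !lexx ?orbT.
  have [y Oy yP] := rx e3 e30.
  have cy : cell lo hi d y by rewrite /cell; lra.
  by exists (T y); [exact: O_fwd|rewrite Tx (exchangeE exchT cy); lra].
- move=> x e1 Kx e10 gx av; have [d [cd xlo Tx]] := Kcell x e1 Kx e10 gx.
  have [xe1 gpx] := gx.
  have nd : ~~ (x - e1 < lo d < x) by apply: av; apply/mapP; exists d; rewrite ?mem_enum.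
  have [? ?] := exchange_img_bnd exchT d.
  rewrite Tx; split; first by lra.
  move=> y Oy yP.
  have cy : cell lo hi d (y - s d) by move: cd; rewrite /cell; lra.
  have Ty : T (y - s d) = y by rewrite (exchangeE exchT cy); lra.
  have [||yz|Oy'] := @O_bwd (y - s d);
    [exact: (cell_in exchT cy)|by rewrite Ty|by rewrite -yz|].
  by have := gpx _ Oy'; lra.
- apply: iter_injective b01; first by move=> y; exact: (exchange_in exchT).
    by move=> ? ?; exact: (exchange_inj exchT).
  by move=> y n; exact: (exchange_aperiodic exchT nc cut).
Qed.

(** Otherwise the infimum of the points of the orbit beyond [a] would be the right end of a gap,
    against [forward_gap]. *)
Lemma orbit_below_gap (a a' : R) : 0 <= a -> a < a' ->
  (forall y, O y -> ~~ (a <= y < a')) -> forall y, O y -> y < a.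
Proof.
move=> a0 aa' av y Oy; rewrite ltNge; apply/negP => ay.
pose E := [set x | O x /\ a <= x].
have infE : has_inf E by split; [exists y|exists a => x []].
have lbE x : E x -> inf E <= x by move=> Ex; apply: ge_inf => //; exists a => ? [].
have geE : a' <= inf E.
  by apply: lb_le_inf; [exists y|move=> x [Ox ax]; have := av x Ox; lra].
apply: (@forward_gap (inf E) (inf E - a)); last first.
- split; first by lra.
  move=> x Ox; apply/negP => xP; have : inf E <= x by apply: lbE; split => //; lra.
  by lra.
- by lra.
- move=> e e0; have [x Ex xe] := inf_adherent e0 infE.
  by exists x; [case: Ex|have := lbE x Ex; lra].
- by have := O_in Oy; have : inf E <= y by [exact: lbE]; lra.
Qed.

(* An orbit avoiding [a, a'[ lies on its left; if m is its supremum, [0, m[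
   and [m, 1[ are both invariant, whence m = T (lo d) = lo c. *)
Lemma avoiding_orbit_dense (a a' : R) : 0 <= a -> a < a' -> a' <= 1 ->
  exists n, a <= iter n T z < a'.
Proof.
move=> a0 aa' a1; apply: contrapT => no.
have av y : O y -> ~~ (a <= y < a').
  by move=> [n ->]; apply/negP => nP; apply: no; exists n.
have below := orbit_below_gap a0 aa' av.
have Oz : O z by exists 0%N.
have supO : has_sup O by split; [exists z|exists a => y /below/ltW].
set m := sup O.
have ubO y : O y -> y <= m by move=> Oy; apply: ub_le_sup => //; exists a => ? /below/ltW.
have ma : m <= a by apply: ge_sup; [exists z|move=> y /below/ltW].
have dense (x e : R) : 0 <= x < m -> 0 < e -> exists2 y, O y & x <= y < x + e.
  move=> /andP[x0 xm] e0; apply: contrapT => nox.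
  have av' y : O y -> ~~ (x <= y < x + e).
    by move=> Oy; apply/negP => yP; apply: nox; exists y.
  have bel := @orbit_below_gap x (x + e) x0 ltac:(lra) av'.
  have : m <= x by apply: ge_sup; [exists z|move=> y /bel/ltW].
  by lra.
(* Otherwise a point of the orbit slightly to the right of [x], in the same cell, would be sent
   beyond [m]. *)
have fwd (x : R) : 0 <= x < m -> T x < m.
  move=> xm; rewrite ltNge; apply/negP => Tx.
  have x01 : 0 <= x < 1 by lra.
  have [d dx] := exchange_cell exchT x01.
  pose e := Num.min (hi d - x) (m - x).
  have [e1 e2] : e <= hi d - x /\ e <= m - x by rewrite /e !ge_min !lexx orbT.
  have e0 : 0 < e by rewrite lt_min; move: dx; rewrite /cell; lra.
  have [||y Oy yP] := dense (x + e / 2) (e / 2); [lra|lra|].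
  have dy : cell lo hi d y by move: dx; rewrite /cell; lra.
  have := ubO _ (O_fwd Oy); move: Tx.
  by rewrite (exchangeE exchT dx) (exchangeE exchT dy); lra.
(* Otherwise a point of the orbit slightly to the right of [T x], chosen different from [z], would
   have its preimage in the orbit and beyond [m]. *)
have bwd (x : R) : m <= x -> x < 1 -> m <= T x.
  move=> mx x1; rewrite leNgt; apply/negP => Tx.
  have x01 : 0 <= x < 1 by have := z01; have := ubO z Oz; lra.
  have [d dx] := exchange_cell exchT x01.
  have Tx0 := exchange_in exchT x01.
  pose e := Num.min (Num.min (hi d - x) (m - T x)) (if T x < z then z - T x else 1).
  have e0 : 0 < e by rewrite !lt_min; move: dx; rewrite /cell; case: ifP => ?; lra.
  have [e1 e2] : e <= hi d - x /\ e <= m - T x by rewrite /e !ge_min !lexx ?orbT.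
  have e3 : T x < z -> e <= z - T x by move=> xz; rewrite /e xz !ge_min lexx orbT.
  have [||w Ow wP] := dense (T x + e / 2) (e / 2); [lra|lra|].
  have TxE := exchangeE exchT dx.
  have dw : cell lo hi d (w - s d) by move: dx; rewrite /cell; lra.
  have Tw : T (w - s d) = w by rewrite (exchangeE exchT dw); lra.
  have [||wz|/ubO] := @O_bwd (w - s d); [exact: (cell_in exchT dw)|by rewrite Tw| |lra].
  by rewrite Tw in wz; have := e3; rewrite -wz; lra.
have m_gt0 : 0 < m.
  rewrite lt_neqAle; apply/andP; split; last by have := z01; have := ubO z Oz; lra.
  apply/eqP => m0; apply: (exchange_aperiodic exchT nc cut (n := 0%N) z01) => /=.
  by have := z01; have := ubO _ Oz; have := ubO _ (O_fwd Oz); have := exchange_in exchT z01; lra.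
have m01 : 0 <= m < 1 by lra.
have ap (x : R) : 0 <= x < 1 -> T x <> x := @exchange_aperiodic _ _ _ _ _ _ exchT nc cut x 0%N.
(* When [x] is interior to its cell, moving it slightly to the left makes exactly one of [x] and
   [T x] cross [m], against [fwd] or [bwd]. *)
have slide x d : cell lo hi d x -> lo d != x -> m <= x -> m <= T x -> m = x \/ m = T x -> False.
  move=> dx ldx mx mTx E.
  have ld : lo d < x by rewrite lt_neqAle ldx; case/andP: dx.
  have TxE := exchangeE exchT dx.
  have x01 := cell_in exchT dx.
  have [xTx|Txx] : m = x /\ x < T x \/ m = T x /\ T x < x.
    have /eqP/lt_total/orP[lt|lt] := ap x x01; case: E => E; first [by left|by right|lra].
  - pose e := Num.min (x - lo d) (Num.min (T x - x) x).
    have [e1 [e2 e3]] : e <= x - lo d /\ e <= T x - x /\ e <= x.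
      by rewrite /e !ge_min !lexx ?orbT.
    have e0 : 0 < e by rewrite !lt_min; lra.
    have dxe : cell lo hi d (x - e) by move: dx; rewrite /cell; lra.
    have := fwd (x - e); rewrite (exchangeE exchT dxe); lra.
  - pose e := Num.min (x - lo d) (x - T x).
    have [e1 e2] : e <= x - lo d /\ e <= x - T x.
      by rewrite /e !ge_min !lexx ?orbT.
    have e0 : 0 < e by rewrite !lt_min; lra.
    have dxe : cell lo hi d (x - e) by move: dx; rewrite /cell; lra.
    have := bwd (x - e); rewrite (exchangeE exchT dxe); move: dx; rewrite /cell; lra.
have [c cm] := exchange_cell exchT m01.
have lc : lo c = m.
  by apply/eqP; apply: contraT => lcm; exfalso; apply: (slide m c) => //; [apply: bwd; lra|left].
have [y y01 Ty] := exchange_surj exchT m01.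
have my : m <= y by rewrite leNgt; apply/negP => ym; have := fwd y; rewrite Ty; lra.
have [d dy] := exchange_cell exchT y01.
have ld : lo d = y.
  by apply/eqP; apply: contraT => ldy; exfalso; apply: (slide y d) => //; [rewrite Ty|right].
by apply: (nc (a := d) (b := c) (n := 0%N)); rewrite /= ?ld ?lc ?Ty //; lra.
Qed.

End AvoidingOrbit.

(** Without connections an orbit meets the separation points at most once; past that time
    [avoiding_orbit_dense] applies. *)
Theorem exchange_minimal (z a a' : R) : 0 <= z < 1 -> 0 <= a -> a < a' -> a' <= 1 ->
  exists n, a <= iter n T z < a'.
Proof.
move=> z01 a0 aa' a1.
suff [N NP] : exists N, forall n c, 0 < lo c -> iter n T (iter N T z) <> lo c.
  have [n nP] := avoiding_orbit_dense (iter_exchange_in exchT N z01) NP a0 aa' a1.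
  by exists (n + N)%N; rewrite iterD.
have [[N [c [lc Nc]]]|no] := pselect (exists n c, 0 < lo c /\ iter n T z = lo c); last first.
  by exists 0%N => n c lc nc'; apply: no; exists n, c.
by exists N.+1 => n d ld; rewrite iterS Nc -iterSr; exact: nc.
Qed.

End Minimality.

(** * Interval exchange transformations and exchanges *)

Section RecordOfExchange.
Variables (R : realType) (A : finType).

Lemma iet_tiling (I : interval_exchange R A) : tiling (lo I) (hi I).
Proof.
have [cov /trivIsetP triv ne] := cells_partition I.
have ne' a : lo I a < hi I a.
  by have [z /=] := ne a Logic.I; rewrite in_itv /= => ?; lra.
have D : disjoint_cells (lo I) (hi I).
  move=> a b z az bz; apply: contrapT => /eqP ab.
  have /seteqP[/(_ z) + _] := triv a b Logic.I Logic.I ab.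
  by apply; split; rewrite /= in_itv.
have cellE a z : cell (lo I) (hi I) a z -> 0 <= z < 1.
  move=> az; have /seteqP[/(_ z) + _] := cov; rewrite /= in_itv /=; apply.
  by exists a => //=; rewrite in_itv.
split=> // [a|z z01].
  have lh := ne' a; split=> //; first by have := cellE a (lo I a); rewrite /cell; lra.
  rewrite leNgt; apply/negP => h1.
  have := cellE a (Num.max (lo I a) 1).
  have [? ?] : lo I a <= Num.max (lo I a) 1 /\ 1 <= Num.max (lo I a) 1 by rewrite !le_max !lexx orbT.
  have : Num.max (lo I a) 1 < hi I a by rewrite gt_max lh.
  by rewrite /cell; lra.
have /seteqP[_ /(_ z)] := cov; rewrite /= in_itv /= => /(_ z01)[a _ /=].
by rewrite in_itv; exists a.
Qed.

Lemma total_refl (le : rel A) : total le -> reflexive le.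
Proof. by move=> tot a; have := tot a a; rewrite orbb. Qed.

Lemma iet_ordered (I : interval_exchange R A) a b :
  le1 I a b -> a != b -> hi I a <= lo I b.
Proof.
move=> ab neq; rewrite leNgt; apply/negP => lt.
have lha := tiling_lt a (iet_tiling I); have lhb := tiling_lt b (iet_tiling I).
have := @cells_ordered _ _ I a b (Num.max (lo I a) (lo I b)) (lo I b) ab neq.
rewrite !in_itv /= le_max gt_max !lexx lha lt lhb => /(_ isT isT).
by rewrite gt_max ltxx andbF.
Qed.

Lemma mu_hi (I : interval_exchange R A) a : mu I a = hi I a.
Proof.
have [_ _ tot] := le1_total_order I.
exact: (tiling_down_sum (iet_tiling I) tot (total_refl tot) (@iet_ordered I)).
Qed.

Lemma nu_lt (I : interval_exchange R A) a b : le2 I a b -> a != b ->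
  nu I a <= nu I b - lambda I b.
Proof.
have [anti trans tot] := le2_total_order I; have refl := total_refl tot.
move=> ab neq; rewrite /nu [X in _ <= X - _](bigD1 b) ?refl //= [_ + _ - _]addrC addKr.
rewrite [leLHS]big_mkcond [leRHS]big_mkcond; apply: ler_sum => c _.
have lc : 0 <= lambda I c by have := tiling_lt c (iet_tiling I); rewrite /lambda; lra.
case: ifP => ca; last by case: ifP.
suff -> : le2 I c b && (c != b) by [].
rewrite (trans _ _ _ ca ab); apply: contraNneq neq => E; rewrite -E in ab *.
by apply/eqP/anti; rewrite ab ca.
Qed.

(** By [nu_lt] the image cells [[nu a - lambda a, nu a[] are disjoint; their total length being 1,
    they tile [[0, 1[]. *)
Lemma iet_exchange (I : interval_exchange R A) :
  exchange (lo I) (hi I) (alpha I) (iet_map I).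
Proof.
have til := iet_tiling I; have [bnd cov D] := til.
have [anti trans tot] := le2_total_order I; have refl := total_refl tot.
have lam a : 0 < lambda I a by have := tiling_lt a til; rewrite /lambda; lra.
have loE a : lo I a + alpha I a = nu I a - lambda I a by rewrite /alpha mu_hi /lambda; lra.
have hiE a : hi I a + alpha I a = nu I a by rewrite /alpha mu_hi; lra.
have D2 : disjoint_cells (fun a => lo I a + alpha I a) (fun a => hi I a + alpha I a).
  move=> a b z; rewrite /cell !loE !hiE => az bz.
  apply: contrapT => /eqP ab.
  have [/nu_lt/(_ ab)|/nu_lt] := orP (tot a b); first by lra.
  by rewrite eq_sym => /(_ ab); lra.
split=> //; first apply: sum1_tiling => //.
- move=> a; rewrite loE hiE; split; last 1 first.
  + rewrite -(tiling_sum til) /nu [leLHS]big_mkcond; apply: ler_sum => c _.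
    by have := lam c; rewrite /lambda; case: ifP => _; lra.
  + rewrite /nu (bigD1 a) ?refl //= [_ + _ - _]addrC addKr.
    by apply: sumr_ge0 => c _; exact/ltW/lam.
  + by have := lam a; lra.
- by rewrite -(tiling_sum til); apply: eq_bigr => a _; lra.
- move=> a z az; rewrite /iet_map; case: pickP => [b|/(_ a)]; rewrite in_itv /=.
    by move=> /D/(_ az) ->.
  by move: az; rewrite /cell => ->.
Qed.

Lemma hi_inj (I : interval_exchange R A) : injective (hi I).
Proof.
move=> a b ab; have til := iet_tiling I; have [_ _ D] := til.
have lha := tiling_lt a til; have lhb := tiling_lt b til.
apply: (D a b (Num.max (lo I a) (lo I b))); rewrite /cell le_max gt_max lexx ?orbT.
  by rewrite lha ab lhb.
by rewrite lhb -ab lha.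
Qed.

(** The next cell starts at [hi I a]. With [lo_mu], the points [mu I a] for [a] not maximal are
    exactly the positive left ends. *)
Lemma nonmax_mu (I : interval_exchange R A) a : nonmax I a ->
  exists2 b, 0 < lo I b & mu I a = lo I b.
Proof.
have til := iet_tiling I; have [bnd cov D] := til.
move=> [b ab neq]; rewrite mu_hi; have hl := iet_ordered ab neq.
have [? lha ?] := bnd a; have [? ? ?] := bnd b.
have [|d dP] := cov (hi I a); first lra.
have lod : lo I d = hi I a.
  apply/eqP; rewrite eq_le; apply/andP; split; first by case/andP: dP.
  rewrite leNgt; apply/negP => lt.
  have ad : a = d.
    apply: (D a d (Num.max (lo I a) (lo I d))); rewrite /cell le_max gt_max lexx ?orbT.
      by rewrite lha lt.
    by have := tiling_lt d til; move: dP; rewrite /cell => /andP[_ h1] ->; rewrite (lt_trans lha h1).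
  by move: dP; rewrite -ad /cell ltxx andbF.
by exists d; rewrite lod //; lra.
Qed.

Lemma lo_mu (I : interval_exchange R A) b : 0 < lo I b ->
  exists2 a, nonmax I a & mu I a = lo I b.
Proof.
have til := iet_tiling I; have [bnd cov D] := til; have lh c := tiling_lt c til.
move=> lb; have [|a0 a0P] := cov 0; first lra.
have a0b : lo I a0 < lo I b by move: a0P; rewrite /cell; lra.
pose a := [arg max_(i > a0 | lo I i < lo I b) hi I i]%O.
have [ab maxa] : lo I a < lo I b /\ forall c, lo I c < lo I b -> hi I c <= hi I a.
  by rewrite /a; case: arg_maxP => // i Pi mi; split => // c /mi.
have neq : a != b by apply: contraTneq ab => ->; rewrite ltxx.
have hl : hi I a <= lo I b by apply: disjoint_cells_lt => //; exact: ltW.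
exists a.
  exists b => //; have [_ _ tot] := le1_total_order I.
  have [//|ba] := orP (tot a b).
  have := iet_ordered ba; rewrite eq_sym => /(_ neq).
  by have := lh b; lra.
rewrite mu_hi; apply/eqP; rewrite eq_le hl leNgt; apply/negP => lt.
have [? ? ?] := bnd a; have [? ? ?] := bnd b.
have [|d dP] := cov (hi I a); first lra.
by have := maxa d; move: dP; rewrite /cell; lra.
Qed.

(** A connection makes two orbits meet, or one orbit periodic and hence finite. Conversely,
    aperiodicity makes the orbits infinite, and a common point of two orbits gives a connection once
    iterates are cancelled by injectivity. *)
Lemma regular_no_connection (I : interval_exchange R A) :
  regular I <-> no_connection (lo I) (iet_map I).
Proof.
have ex := iet_exchange I.
split=> [[inf /trivIsetP triv] b c n /lo_mu[a na <-] /lo_mu[a' na' <-] E|nc].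
  have [aa'|neq] := eqVneq a a'; last first.
    have /seteqP[/(_ (mu I a')) + _] := triv _ _ na na' neq.
    by apply; split; [exists n.+1; left|exists 0%N; left].
  rewrite -aa' in E; apply: (inf a na).
  apply: (@sub_finite_set _ _ [set` [seq iter k (iet_map I) (mu I a) | k <- iota 0 n.+1]]).
    have [d _ mua] := nonmax_mu na.
    have mu01 : 0 <= mu I a < 1 by rewrite mua; exact: (lo_in ex).
    have per k : iter (k * n.+1) (iet_map I) (mu I a) = mu I a.
      by elim: k => // k IH; rewrite mulSn iterD IH.
    move=> y [k kP]; suff [j jn ->] : exists2 j, (j < n.+1)%N & y = iter j (iet_map I) (mu I a).
      by rewrite /mkset; apply/mapP; exists j => //; rewrite mem_iota.
    case: kP => [<-|ky].
      exists (k %% n.+1)%N; first by rewrite ltn_mod.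
      by rewrite {1}(divn_eq k n.+1) addnC iterD per.
    (* A backward iterate is also a forward one, since [k + k * n] is a multiple of the period
       [n.+1]. *)
    exists ((k * n) %% n.+1)%N; first by rewrite ltn_mod.
    have y01 : 0 <= y < 1.
      have [//|ny] := boolP (0 <= y < 1).
      have fix_y j : iter j (iet_map I) y = y.
        elim: j => //= j ->; rewrite /iet_map; case: pickP => // e.
        by rewrite in_itv /= => /(cell_in ex); rewrite (negbTE ny).
      by move: ny; rewrite -(fix_y k) ky mu01.
    apply: (iter_exchange_inj ex (n := k)) => //.
      exact: (iter_exchange_in ex).
    have E' : (k * n.+1 = k + (k * n) %% n.+1 + (k * n) %/ n.+1 * n.+1)%N.
      by have := divn_eq (k * n) n.+1; rewrite mulnS; lia.
    by rewrite ky -iterD -[LHS](per k) E' iterD per.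
  exact: finite_seq.
split=> [a na|].
  have [d ld mua] := nonmax_mu na.
  have mu01 : 0 <= mu I a < 1 by rewrite mua; exact: (lo_in ex).
  have cut : exists a, 0 < lo I a by exists d.
  apply: (@sub_infinite_set _ (range (fun n => iter n (iet_map I) (mu I a)))).
    by move=> _ [n _ <-]; exists n; left.
  have inj : injective (fun n => iter n (iet_map I) (mu I a)).
    apply: iter_injective mu01.
    - by move=> y; exact: (exchange_in ex).
    - by move=> y z; exact: (exchange_inj ex).
    - by move=> y n; exact: (exchange_aperiodic ex nc cut).
  apply/infiniteP; have := card_ge_preimage (B := range (fun n => iter n (iet_map I) (mu I a))) (in2W inj).
  rewrite (_ : _ @^-1` _ = setT) //.
  by apply/seteqP; split => // n _; exists n.
apply/trivIsetP => a a' na na' neq; apply/seteqP; split => // y [].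
have [d ld mua] := nonmax_mu na; have [d' ld' mua'] := nonmax_mu na'.
rewrite mua mua'; set x := lo I d; set x' := lo I d'.
have xx' : x <> x'.
  move=> E; move/eqP: neq; apply; apply: (@hi_inj I).
  by rewrite -!mu_hi mua mua'.
have noc n : iter n (iet_map I) x <> x' by case: n => [//|n]; exact: nc.
have noc' n : iter n (iet_map I) x' <> x by case: n => [|n]; [move=> /esym|exact: nc].
have x01 : 0 <= x < 1 by exact: (lo_in ex).
have x'01 : 0 <= x' < 1 by exact: (lo_in ex).
move=> [n [nx|ny]] [m [mx'|my]].
- have [nm|mn] := leqP n m.
    apply: (noc' (m - n)%N); apply: (iter_exchange_inj ex (n := n)) => //.
      exact: (iter_exchange_in ex).
    by rewrite -iterD subnKC // mx' nx.
  apply: (noc (n - m)%N); apply: (iter_exchange_inj ex (n := m)) => //.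
    exact: (iter_exchange_in ex).
  by rewrite -iterD subnKC ?(ltnW mn) // mx' nx.
- by apply: (noc (m + n)%N); rewrite iterD nx.
- by apply: (noc' (n + m)%N); rewrite iterD mx'.
- have [nm|mn] := leqP n m.
    by apply: (noc (m - n)%N); rewrite -ny -iterD subnK.
  by apply: (noc' (n - m)%N); rewrite -my -iterD subnK // ltnW.
Qed.

(** The two orders are those of the left ends of the cells and of their images; [nu] is then the
    right end of the image cell, so that [alpha] is [s]. *)
Lemma exchange_iet (lo hi s : A -> R) (T : R -> R) : exchange lo hi s T ->
  exists2 I : interval_exchange R A, Defs.lo I = lo /\ Defs.hi I = hi
    & forall z, 0 <= z < 1 -> iet_map I z = T z.
Proof.
move=> ex; have [til til2 TE] := ex; have [bnd cov D] := til.
have tot1 : total_order (fun a b => lo a <= lo b).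
  split=> [a b|b a c|a b]; [by move=> /le_anti /(lo_inj ex)|exact: le_trans|exact: le_total].
have tot2 : total_order (fun a b => lo a + s a <= lo b + s b).
  split=> [a b|b a c|a b]; [|exact: le_trans|exact: le_total].
  move=> /le_anti E; have [_ _ D2] := til2; apply: (D2 a b (lo a + s a)); rewrite /cell.
    by have := tiling_lt a til2; lra.
  by have := tiling_lt b til2; rewrite E; lra.
have part : classical_sets.partition [set: A] (fun a => [set` `[lo a, hi a[]) [set` `[0, 1[].
  split.
  - apply/seteqP; split=> [z [a _]|z] /=; rewrite in_itv /=; first exact: (cell_in ex).
    by move=> /cov[a az]; exists a => //=; rewrite in_itv.
  - apply/trivIsetP => a b _ _ ab; apply/seteqP; split=> // z [] /=.
    by rewrite !in_itv /= => az bz; rewrite (D a b z az bz) eqxx in ab.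
  - by move=> a _; exists (lo a); rewrite /= in_itv /= lexx; exact: tiling_lt til.
have ord a b y z : lo a <= lo b -> a != b -> y \in `[lo a, hi a[ -> z \in `[lo b, hi b[ -> y < z.
  move=> ab neq; rewrite !in_itv /= => ay bz.
  have : hi a <= lo b by apply: (disjoint_cells_lt _ D) => // c; exact: tiling_lt til.
  by lra.
pose I := IntervalExchange tot1 tot2 part ord.
exists I => // z /cov[a az].
have [_ _ t2] := tot2.
have nuE : nu I a = hi a + s a.
  rewrite -(tiling_down_sum til2 t2 (total_refl t2)); last first.
    have [_ _ D2] := til2.
    move=> b c bc neq; apply: (disjoint_cells_lt _ D2) => // d.
    exact: tiling_lt til2.
  by apply: eq_bigr => b _; rewrite /lambda /=; lra.
rewrite (exchangeE (iet_exchange I) az) (TE a z az) /alpha mu_hi nuE /=; lra.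
Qed.

End RecordOfExchange.

(** * Cylinders and decoding *)

Section Words.
Variables (R : realType) (A : finType) (lo hi s : A -> R) (T : R -> R).
Implicit Types (w : seq A) (z : R).

Fixpoint itinerary w z : bool :=
  if w is a :: w' then cell lo hi a z && itinerary w' (T z) else 0 <= z < 1.

(** The cylinder of [a :: w'] is the cell of [a] intersected with the cylinder of [w'] translated by
    [- s a]; it is empty when its ends are not in increasing order. *)
Fixpoint cyl_lo w : R :=
  if w is a :: w' then Num.max (lo a) (cyl_lo w' - s a) else 0.

Fixpoint cyl_hi w : R :=
  if w is a :: w' then Num.min (hi a) (cyl_hi w' - s a) else 1.

Definition cyl_shift w : R := \sum_(a <- w) s a.

Hypothesis ex : exchange lo hi s T.

Lemma itineraryE w z : itinerary w z = (cyl_lo w <= z < cyl_hi w).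
Proof.
elim: w z => [|a w IH] z //=; rewrite ge_max lt_min IH.
have [az|naz] /= := boolP (cell lo hi a z).
  rewrite (exchangeE ex az); move: az; rewrite /cell => /andP[-> ->] /=.
  by rewrite lerBlDr ltrBrDr.
by apply/esym/negP => /andP[/andP[? _] /andP[? _]]; move: naz; rewrite /cell; lra.
Qed.

Lemma itinerary_in w z : itinerary w z -> 0 <= z < 1.
Proof. by case: w => //= a w /andP[/(cell_in ex)]. Qed.

Lemma itinerary_iter w z : itinerary w z -> iter (size w) T z = z + cyl_shift w.
Proof.
rewrite /cyl_shift; elim: w z => [|a w IH] z /=; first by rewrite big_nil addr0.
move=> /andP[az wz]; rewrite -iterS iterSr IH // big_cons (exchangeE ex az); lra.
Qed.

Lemma itinerary_cat w w' z :
  itinerary (w ++ w') z = itinerary w z && itinerary w' (iter (size w) T z).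
Proof.
elim: w z => [|a w IH] z /=; last by rewrite IH -iterS iterSr andbA.
by apply/idP/andP => [wz|[]//]; split=> //; exact: itinerary_in wz.
Qed.

Lemma itinerary_prefix w w' z : itinerary w z -> itinerary w' z ->
  (size w <= size w')%N -> seq.prefix w w'.
Proof.
elim: w w' z => [|a w IH] [|b w'] z //= /andP[az wz] /andP[bz w'z] le.
by rewrite (exchange_disj ex az bz) eqxx /=; apply: IH wz w'z _.
Qed.

Lemma prefix_size_eq w w' : seq.prefix w w' -> size w = size w' -> w = w'.
Proof.
move=> /prefixP[v ->] /eqP; rewrite size_cat -[X in X == _]addn0 eqn_add2l.
by case: v => // _; rewrite cats0.
Qed.

(** By injectivity of [T], the point [z] lies on the orbit of [z'], and [w] is read there as the end
    of [w']. *)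
Lemma itinerary_suffix w w' z z' : itinerary w z -> itinerary w' z' ->
  iter (size w) T z = iter (size w') T z' -> (size w <= size w')%N -> suffix w w'.
Proof.
move=> wz w'z' E le; set k := (size w' - size w)%N.
have sk : size (take k w') = k by rewrite size_takel // leq_subr.
have := w'z'; rewrite -{1}(cat_take_drop k w') itinerary_cat sk => /andP[_ dz].
have zE : z = iter k T z'.
  apply: (iter_exchange_inj ex (n := size w)); first exact: itinerary_in wz.
    exact: itinerary_in dz.
  by rewrite E -iterD subnKC.
apply/suffixP; exists (take k w'); rewrite -{1}(cat_take_drop k w'); congr (_ ++ _).
have sd : size w = size (drop k w') by rewrite size_drop subKn.
by apply/esym/prefix_size_eq => //; apply: itinerary_prefix dz _; rewrite -?zE ?sd.
Qed.

Lemma itinerary_exists z n : 0 <= z < 1 -> exists2 w, size w = n & itinerary w z.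
Proof.
elim: n z => [|n IH] z z01; first by exists [::].
have [a az] := exchange_cell ex z01.
have [w sw wz] := IH _ (exchange_in ex z01).
by exists (a :: w) => /=; rewrite ?sw // az.
Qed.

Lemma cyl_bnd w : 0 <= cyl_lo w /\ cyl_hi w <= 1.
Proof.
case: w => //= a w; have [? ? ?] := exchange_bnd ex a.
by rewrite le_max ge_min; split; apply/orP; left.
Qed.

(** Either the maximum defining the left end is [lo a], or [T] sends it to the left end of the
    cylinder of the tail. *)
Lemma cyl_lo_cut w : itinerary w (cyl_lo w) -> 0 < cyl_lo w ->
  exists k a, [/\ (k < size w)%N, 0 < lo a & iter k T (cyl_lo w) = lo a].
Proof.
elim: w => [|a w IH] /=; first by rewrite ltxx.
set l := Num.max _ _; move=> /andP[al wl] l0.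
have [El|] := eqVneq l (lo a); first by exists 0%N, a; rewrite -El.
move=> ne; have {ne}lE : l = cyl_lo w - s a.
  by move: ne; rewrite /l; case: (leP (lo a)) => //; rewrite eqxx.
have Tl : T l = cyl_lo w by rewrite (exchangeE ex al) lE; lra.
have [w0|nw0] := ltP 0 (cyl_lo w).
  have [|k [b [ks lb kb]]] := IH _ w0; first by rewrite -Tl.
  by exists k.+1, b; split=> //; rewrite iterSr Tl.
(* If the cylinder of the tail starts at 0, then [l = - s a], which is at most [lo a] as the image
   cell lies in [[0, 1[]; hence [l = lo a]. *)
have [? _] := cyl_bnd w; have [? ?] := exchange_img_bnd ex a.
by exists 0%N, a; move: al l0; rewrite /cell lE /= => ? ?; split=> //; lra.
Qed.

End Words.

(** * Factors of natural codings as itineraries *)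

Lemma natural_coding_itinerary (R : realType) (A : finType)
    (I : interval_exchange R A) u z w : 0 <= z < 1 -> natural_coding I z u ->
  factors u w <-> exists n, itinerary (lo I) (hi I) (iet_map I) w (iter n (iet_map I) z).
Proof.
move=> z01 uz; have ex := iet_exchange I.
suff key n : w = map u (iota n (size w)) <->
    itinerary (lo I) (hi I) (iet_map I) w (iter n (iet_map I) z).
  by split=> -[n /key]; exists n.
elim: w n => [|a w IH] n /=; first by split=> // _; exact: (iter_exchange_in ex).
have [u1 u2] := uz n a; rewrite in_itv /= in u1 u2.
split=> [[/esym an wn]|/andP[an /(IH n.+1) <-]]; last by rewrite u2.
by rewrite /cell u1 //=; apply/(IH n.+1).
Qed.

(** Infinite codings are eliminated: a word belongs to [S] iff it is read somewhere along the orbit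
    of [z], whatever [z] is. *)
Lemma regular_interval_exchange_setP (R : realType) (A : finType) (S : set (seq A)) :
  regular_interval_exchange_set R S <->
  exists2 I : interval_exchange R A, regular I & forall z w, 0 <= z < 1 ->
    S w <-> exists n, itinerary (lo I) (hi I) (iet_map I) w (iter n (iet_map I) z).
Proof.
split=> -[I regI IP]; exists I => // z; first move=> w z01.
  have [|u uz ->] := IP z; first by rewrite in_itv.
  exact: natural_coding_itinerary.
rewrite in_itv /= => z01; have ex := iet_exchange I.
have /choice[u uP] : forall n, exists a, cell (lo I) (hi I) a (iter n (iet_map I) z).
  by move=> n; apply: (exchange_cell ex); exact: (iter_exchange_in ex).
have uz : natural_coding I z u.
  move=> n a; rewrite in_itv /=; split=> [<-|]; first exact: uP.
  by move=> /(exchange_disj ex (uP n)).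
exists u => //; apply/seteqP; split=> w.
  by move=> /(IP z w z01)/(natural_coding_itinerary w z01 uz).
by move=> /(natural_coding_itinerary w z01 uz)/(IP z w z01).
Qed.

(** * The exchange defined by a maximal bifix code *)

Section Decoding.
Variables (R : realType) (A B : finType) (lo hi s : A -> R) (T : R -> R).
Variables (S : set (seq A)) (x : B -> seq A).
Local Notation itin := (itinerary lo hi T).
Hypothesis ex : exchange lo hi s T.
Hypothesis SP : forall z w, 0 <= z < 1 -> S w <-> exists n, itin w (iter n T z).
Hypothesis x_S : forall b, S (x b).
Hypothesis x_prefix : forall b c, seq.prefix (x b) (x c) -> b = c.
Hypothesis x_suffix : forall b c, suffix (x b) (x c) -> b = c.
Hypothesis x_max : forall y, y <> [::] -> S y -> exists b,
  [\/ seq.prefix (x b) y, seq.prefix y (x b), suffix (x b) y | suffix y (x b)].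

Let l b := cyl_lo lo s (x b).
Let h b := cyl_hi hi s (x b).
Let sh b := cyl_shift s (x b).

Lemma factor_itinerary w : S w <-> exists z, itin w z.
Proof.
have z01 : 0 <= (0 : R) < 1 by lra.
split=> [/(SP w z01)[n]|[z wz]]; first by eexists; eassumption.
by apply/(SP w (itinerary_in ex wz)); exists 0%N.
Qed.

Lemma code_bnd b : [/\ 0 <= l b, l b < h b & h b <= 1].
Proof.
have /factor_itinerary[z] := x_S b; rewrite (itineraryE ex) => zP.
by have [? ?] := cyl_bnd ex (x b); split=> //; rewrite /l /h; lra.
Qed.

Lemma code_cellE b z : cell l h b z = itin (x b) z.
Proof. by rewrite (itineraryE ex). Qed.

Lemma code_disj : disjoint_cells l h.
Proof.
move=> b c z; rewrite !code_cellE => bz cz.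
have [le|/ltnW le] := leqP (size (x b)) (size (x c)).
  exact/x_prefix/(itinerary_prefix ex bz cz).
exact/esym/x_prefix/(itinerary_prefix ex cz bz).
Qed.

Lemma code_img_cell b y : cell (fun b => l b + sh b) (fun b => h b + sh b) b y ->
  exists2 z, itin (x b) z & y = iter (size (x b)) T z.
Proof.
rewrite /cell => yP.
have bz : itin (x b) (y - sh b) by rewrite -code_cellE /cell; lra.
by exists (y - sh b) => //; rewrite (itinerary_iter ex bz) -/(sh b); lra.
Qed.

(** Two code words read just before the same point are comparable for the suffix order. *)
Lemma code_img_disj : disjoint_cells (fun b => l b + sh b) (fun b => h b + sh b).
Proof.
move=> b c y /code_img_cell[z bz ->] /code_img_cell[z' cz' E].
have [le|/ltnW le] := leqP (size (x b)) (size (x c)).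
  exact/x_suffix/(itinerary_suffix ex bz cz').
exact/esym/x_suffix/(itinerary_suffix ex cz' bz).
Qed.

Lemma code_img_bnd b : [/\ 0 <= l b + sh b, l b + sh b < h b + sh b & h b + sh b <= 1].
Proof.
have [l0 lh h1] := code_bnd b.
have key y : l b + sh b <= y < h b + sh b -> 0 <= y < 1.
  by move=> /code_img_cell[z /(itinerary_in ex) z01 ->]; exact: (iter_exchange_in ex).
have := key (l b + sh b); split; [lra|lra|].
rewrite leNgt; apply/negP => lt.
have := key (Num.max (l b + sh b) 1).
have [? ?] : l b + sh b <= Num.max (l b + sh b) 1 /\ 1 <= Num.max (l b + sh b) 1.
  by rewrite !le_max !lexx orbT.
have : Num.max (l b + sh b) 1 < h b + sh b by rewrite gt_max; lra.
by lra.
Qed.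

(** [w'] is read along every orbit, in particular along the one that starts right after a reading of
    [w]. *)
Lemma recurrent w w' : S w -> S w' -> exists y,
  [/\ S y, seq.prefix w y & suffix w' y].
Proof.
move=> /factor_itinerary[z wz] Sw'.
have z01 := itinerary_in ex wz.
have [n w'n] : exists n, itin w' (iter n T (iter (size w) T z)).
  by apply/SP => //; exact: (iter_exchange_in ex).
have [v sv vz] := itinerary_exists ex n (iter_exchange_in ex (size w) z01).
exists (w ++ v ++ w'); split; last 2 first.
- by apply/prefixP; exists (v ++ w').
- by apply/suffixP; exists (w ++ v); rewrite catA.
- by apply/factor_itinerary; exists z; rewrite !(itinerary_cat ex) wz vz sv w'n.
Qed.

(* A point outside the cells [l b, h b[ yields, the total length being below 1,
   a point outside their images; a long word joining the future of the former
   to the past of the latter could be added to the code. *)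
Lemma code_tiling : tiling l h.
Proof.
split; [exact: code_bnd| |exact: code_disj] => z z01.
apply: contrapT => nz.
have sum_ne1 : \sum_b (h b - l b) <> 1.
  by move=> /(sum1_tiling code_bnd code_disj)[_ /(_ z z01)].
have [z' z'01 nz'] : exists2 z', 0 <= z' < 1 &
    ~ exists b, cell (fun b => l b + sh b) (fun b => h b + sh b) b z'.
  apply: contrapT => no; apply: sum_ne1.
  have : tiling (fun b => l b + sh b) (fun b => h b + sh b).
    split; [exact: code_img_bnd| |exact: code_img_disj] => z' z'01.
    by apply: contrapT => nz'; apply: no; exists z'.
  by move=> /tiling_sum <-; apply: eq_bigr => b _; lra.
(* [N] exceeds the length of every code word, so a code word that is a prefix or a suffix of [y]
   lies within [w] or [w']. *)
pose N := (\max_b size (x b)).+1.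
have xN b : (size (x b) < N)%N by rewrite ltnS; exact: leq_bigmax.
have [y' y'01 y'z'] : exists2 y', 0 <= y' < 1 & iter N T y' = z'.
  elim: N {xN} => [|n [y y01 yz']]; first by exists z'.
  have [y2 y201 Ty2] := exchange_surj ex y01.
  by exists y2 => //; rewrite iterSr Ty2.
have [w sw wz] := itinerary_exists ex N z01.
have [w' sw' w'y'] := itinerary_exists ex N y'01.
have [||y [Sy wy w'y]] := @recurrent w w';
  [by apply/factor_itinerary; exists z|by apply/factor_itinerary; exists y'|].
have sy : (N <= size y)%N by rewrite -sw; exact: size_prefix wy.
have [||b] := x_max (y := y); [by move=> y0; rewrite y0 in sy|by []|].
have x_w : ~ seq.prefix (x b) w.
  move=> /prefixP[v wE]; apply: nz; exists b; rewrite code_cellE.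
  by move: wz; rewrite wE (itinerary_cat ex) => /andP[].
have x_w' : ~ suffix (x b) w'.
  move=> /suffixP[v wE]; apply: nz'; exists b.
  move: w'y'; rewrite wE (itinerary_cat ex) => /andP[_ bv].
  have := bv; rewrite -code_cellE /cell => cv.
  suff -> : z' = iter (size v) T y' + sh b by lra.
  by rewrite -(itinerary_iter ex bv) -iterD -y'z' -sw' wE size_cat addnC.
case.
- move: wy => /prefixP[v ->]; rewrite prefixE take_cat sw.
  by rewrite xN => /eqP E; apply: x_w; rewrite prefixE E.
- by move=> /size_prefix; rewrite leqNgt (leq_trans (xN b) sy).
- move: w'y => /suffixP[v ->]; rewrite suffixE size_cat drop_cat.
  have -> : (size v + size w' - size (x b) < size v)%N = false by have := xN b; rewrite -sw'; lia.
  move=> /eqP E; apply: x_w'; rewrite suffixE; apply/eqP; rewrite -[RHS]E; congr drop.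
  by have := xN b; rewrite -sw'; lia.
- by move=> /size_suffix; rewrite leqNgt (leq_trans (xN b) sy).
Qed.

Definition decoded_map (z : R) : R :=
  if [pick b | itin (x b) z] is Some b then iter (size (x b)) T z else z.

Lemma decoded_mapE b z : itin (x b) z -> decoded_map z = iter (size (x b)) T z.
Proof.
rewrite /decoded_map -code_cellE => bz; case: pickP => [c|/(_ b)].
  by rewrite -code_cellE => /code_disj/(_ bz) ->.
by rewrite -code_cellE bz.
Qed.

Lemma decoded_exchange : exchange l h sh decoded_map.
Proof.
split; first exact: code_tiling.
- apply: sum1_tiling; [exact: code_img_bnd|exact: code_img_disj|].
  by rewrite -(tiling_sum code_tiling); apply: eq_bigr => b _; lra.
- by move=> b z; rewrite code_cellE => bz; rewrite (decoded_mapE bz) (itinerary_iter ex bz).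
Qed.

Lemma iter_decoded_map n z : 0 <= z < 1 ->
  exists m, iter n decoded_map z = iter m T z.
Proof.
move=> z01; elim: n => [|n [m nm]]; first by exists 0%N.
have [_ cov _] := code_tiling.
have [b] := cov _ (iter_exchange_in ex m z01); rewrite code_cellE => bz.
by exists (size (x b) + m)%N; rewrite iterS nm (decoded_mapE bz) iterD.
Qed.

(* The left end l b precedes a left end lo c strictly before |x b| steps of T,
   so that an orbit from l b to l b' contains one from lo c to some lo c'. *)
Lemma decoded_no_connection : no_connection lo T -> no_connection l decoded_map.
Proof.
move=> nc b b' n lb lb' E.
have in_l c : itin (x c) (l c).
  by rewrite -code_cellE /cell lexx; have [_ -> _] := code_bnd c.
have [k [c [kx lc kc]]] := cyl_lo_cut ex (in_l b) lb.
have [k' [c' [_ lc' kc']]] := cyl_lo_cut ex (in_l b') lb'.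
have l01 := itinerary_in ex (in_l b).
move: E; rewrite iterSr (decoded_mapE (in_l b)).
have [m ->] := iter_decoded_map n (iter_exchange_in ex (size (x b)) l01) => E.
(* Of the [size (x b)] steps, [k] precede [lo c]; since [k < size (x b)], at least one step remains,
   as a connection requires. *)
apply: (nc c c' (k' + m + (size (x b) - k.+1))%N lc lc').
rewrite -kc' -/(l b') -E -kc -!iterD; congr (iter _ T _).
by move: (size (x b)) kx => N kx; lia.
Qed.

Lemma itinerary_decode w z :
  itinerary l h decoded_map w z = itin (flatten (map x w)) z.
Proof.
elim: w z => //= b w IH z; rewrite (itinerary_cat ex) code_cellE.
by have [bz|] //= := boolP (itin (x b) z); rewrite IH (decoded_mapE bz).
Qed.

(** The cylinder of [w] for the decoded map is that of its decoding for [T]; when nonempty it is a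
    semi-interval, met by every orbit by minimality. *)
Lemma decoded_factors z w : no_connection lo T -> 0 <= z < 1 ->
  S (flatten (map x w)) <-> exists n, itinerary l h decoded_map w (iter n decoded_map z).
Proof.
move=> nc z01; have ex' := decoded_exchange.
split=> [/factor_itinerary[y]|[n]]; last first.
  by rewrite itinerary_decode => wz; apply/factor_itinerary; eexists; exact: wz.
rewrite -itinerary_decode (itineraryE ex') => wy.
have [cut|nocut] := pselect (exists b, 0 < l b).
  have [? ?] := cyl_bnd ex' w.
  have [//||//|n nP] := exchange_minimal ex' (decoded_no_connection nc) cut z01
    (a := cyl_lo l sh w) (a' := cyl_hi h sh w); first by lra.
  by exists n; rewrite (itineraryE ex').
(* In this case all cells contain 0, so [B] has a single letter and every word is read at every
   point. *)
have l0 b : l b = 0.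
  have [? ? ?] := code_bnd b; apply/eqP; rewrite eq_le; apply/andP; split=> //.
  by rewrite leNgt; apply/negP => lb; apply: nocut; exists b.
exists 0%N => /=; elim: w z z01 {wy} => //= b w IH z z01.
rewrite IH ?andbT; last exact: (exchange_in ex').
have [c cz] := exchange_cell ex' z01.
suff -> : b = c by [].
have in0 d : cell l h d 0 by have [_ lh _] := code_bnd d; move: lh; rewrite /cell l0 lexx.
exact: code_disj (in0 b) (in0 c).
Qed.

End Decoding.

(** * Closure under maximal bifix decoding *)

Theorem theorem3p13 (R : realType) (A B : finType) (S X : set (seq A))
    (f : seq B -> seq A) :
  regular_interval_exchange_set R S ->
  finite_set X ->
  maximal_bifix_code S X ->
  coding_morphism X f ->
  regular_interval_exchange_set R (f @^-1` S).
Proof.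
move=> /regular_interval_exchange_setP[I /regular_no_connection nc SP] _.
move=> [[X0 Xpre Xsuf] XS Xmax] [[f0 fM] [fX f_inj f_surj]].
pose x b := f [:: b].
have Xx b : X (x b) by exact: fX.
have fE w : f w = flatten (map x w).
  by elim: w => [//|b w IH]; rewrite -cat1s fM IH.
have ex := iet_exchange I.
have xpre b c : seq.prefix (x b) (x c) -> b = c.
  by move=> /(Xpre _ _ (Xx b) (Xx c))/f_inj; apply; exact: in_setT.
have xsuf b c : suffix (x b) (x c) -> b = c.
  by move=> /(Xsuf _ _ (Xx b) (Xx c))/f_inj; apply; exact: in_setT.
(* Otherwise y could be added to X. *)
have xmax y : y <> [::] -> S y -> exists b,
    [\/ seq.prefix (x b) y, seq.prefix y (x b), suffix (x b) y | suffix y (x b)].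
  move=> y0 Sy; apply: contrapT => no.
  have noX v : X v -> [/\ ~ seq.prefix v y, ~ seq.prefix y v, ~ suffix v y & ~ suffix y v].
    by move=> /f_surj[b _ <-]; split=> ?; apply: no; exists b;
      [exact: Or41|exact: Or42|exact: Or43|exact: Or44].
  apply: (Xmax (X `|` [set y])).
  - split=> [[//|/esym //]|u v|u v].
    + by case=> [Xu|->] [Xv|->] //; [exact: Xpre|case: (noX u Xu)|case: (noX v Xv)].
    + by case=> [Xu|->] [Xv|->] //; [exact: Xsuf|case: (noX u Xu)|case: (noX v Xv)].
  - by move=> v [/XS|->].
  - split=> [v Xv|/(_ y) yX]; first by left.
    have [] := noX y; first by apply: yX; right.
    by move=> /(_ (prefix_refl y)).
have ex' := decoded_exchange ex SP (fun b => XS _ (Xx b)) xpre xsuf xmax.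
have nc' := decoded_no_connection ex SP (fun b => XS _ (Xx b)) xpre xsuf xmax nc.
(* The maps of [J] and of the decoding agree on [[0, 1[], which is invariant, so iterates and
   itineraries can be transferred. *)
have [J [loJ hiJ] mapJ] := exchange_iet ex'.
have iterJ n z : 0 <= z < 1 -> iter n (iet_map J) z = iter n (decoded_map (lo I) (hi I) (iet_map I) x) z.
  move=> z01; elim: n => //= n ->; apply: mapJ; exact: (iter_exchange_in ex').
have itJ w z : 0 <= z < 1 -> itinerary (lo J) (hi J) (iet_map J) w z =
    itinerary (lo J) (hi J) (decoded_map (lo I) (hi I) (iet_map I) x) w z.
  by elim: w z => //= b w IH z z01; rewrite mapJ // IH //; exact: (exchange_in ex').
apply/regular_interval_exchange_setP; exists J.
  apply/regular_no_connection => b c n lb lc; rewrite iterJ ?loJ; last exact: (lo_in ex').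
  by rewrite loJ in lb lc; exact: nc'.
move=> z w z01; rewrite /preimage /= fE.
have := decoded_factors ex SP (fun b => XS _ (Xx b)) xpre xsuf xmax w nc z01.
move=> ->; split=> -[n nP]; exists n; move: nP; rewrite -(iterJ n z z01) itJ ?loJ ?hiJ //;
  by rewrite iterJ //; exact: (iter_exchange_in ex').
Qed.
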